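(* Let $\mathbb K$ be a field of characteristic zero and let $a(n), b(n)\in\mathbb K[n]$ be two nonzero polynomials. Let $$k_0=\mathrm{dis}(a(n-1),b(n))=\max\{k\in\mathbb N \mid \deg\gcd(a(n-1),b(n+k))\ge 1\},$$ with $k_0=-1$ if no such $k$ exists. For $k\ge 0$ define $$G_k(n)=\gcd\bigl(b(n)b(n+1)\cdots b(n+k-1),\; a(n-1)a(n-2)\cdots a(n-k)\bigr).$$ Then the sequence $G_1(n),G_2(n),\ldots$ converges to $G_{k_0+1}(n)$.
   Context: $\mathbb N$ is the set of nonnegative integers. The gcd of two polynomials in $\mathbb K[n]$ is always normalized to be monic. For $a(n),b(n)\in\mathbb K[n]$, the dispersion $\mathrm{dis}(a(n),b(n))$ is the greatest nonnegative integer $k$ such that $a(n)$ and $b(n+k)$ have a nontrivial (positive degree) common divisor, and it is set to $-1$ if no such $k$ exists. Empty products equal $1$, so $G_0(n)=1$. A sequence of polynomials $G_1(n),G_2(n),\ldots$ converges to a polynomial $G(n)$ if it is eventually constant with value $G(n)$, i.e. $G_k(n)=G(n)$ for all sufficiently large $k$. *)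

(* Defs.v *)
From mathcomp Require Import all_boot all_order all_algebra.
From mathcomp Require Import boolp classical_sets.

Set Implicit Arguments.
Unset Strict Implicit.
Unset Printing Implicit Defensive.
Import GRing.Theory.
Local Open Scope ring_scope.

Section Definitions.
Variable K : fieldType.
Implicit Types p q a b g : {poly K}.

(* p(n + z), where the variable 'X stands for n *)
Definition shift_poly p (z : int) : {poly K} := p \Po ('X + (z%:~R)%:P).

(* gcdp is only specified up to a nonzero scalar; gcd 0 0 = 0 *)
Definition monic_gcd p q : {poly K} := (lead_coef (gcdp p q))^-1 *: gcdp p q.

(* p(n) and q(n + k) have a common divisor of positive degree *)
Definition has_common_shift p q (k : nat) : bool :=
  (1 < size (monic_gcd p (shift_poly q k%:Z)))%N.

Definition is_max_common_shift p q (d : int) : Prop :=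
  exists k : nat, [/\ d = k%:Z, has_common_shift p q k &
    forall j : nat, has_common_shift p q j -> (j <= k)%N].

(* The default -1 is meant for the case where no k satisfies has_common_shift.
   By disP below, this is the only case in which it is returned when p and q
   are nonzero and K has characteristic 0. *)
Definition dis p q : int := xget (-1) [set d | is_max_common_shift p q d].

Definition G_ a b (k : nat) : {poly K} :=
  monic_gcd (\prod_(0 <= i < k) shift_poly b i%:Z)
            (\prod_(1 <= i < k.+1) shift_poly a (- i%:Z)).

Definition poly_seq_converges (u : nat -> {poly K}) g : Prop :=
  exists N : nat, forall k : nat, (N <= k)%N -> u k = g.

End Definitions.

Lemma monic_gcd_monic (K : fieldType) (p q : {poly K}) :
  (p != 0) || (q != 0) -> monic_gcd p q \is monic.
Proof.
move=> pq0; rewrite /monic_gcd monicE lead_coefZ mulVf //.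
by rewrite lead_coef_eq0 gcdp_eq0 negb_and.
Qed.

Lemma monic_gcd_eqp (K : fieldType) (p q : {poly K}) :
  monic_gcd p q %= gcdp p q.
Proof.
rewrite /monic_gcd; have [->|g0] := eqVneq (gcdp p q) 0; first by rewrite scaler0 eqpxx.
by rewrite eqp_scale // invr_eq0 lead_coef_eq0.
Qed.

Lemma has_common_shift_root (K : fieldType) (p q : {poly K}) (k : nat) :
  p != 0 -> q != 0 -> has_common_shift p q k ->
  root (sub_annihilant q p) k%:R.
Proof.
move=> p0 q0; rewrite /has_common_shift (eqp_size (monic_gcd_eqp _ _)).
set qk := shift_poly q k%:Z => gcd_gt1.
have size_qk : size qk = size q by rewrite size_comp_poly2 // size_XaddC.
have qk0 : qk != 0 by rewrite -size_poly_eq0 size_qk size_poly_eq0.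
have p_gt1 : (1 < size p)%N by apply: leq_trans gcd_gt1 (leq_gcdpl _ p0).
have q_gt1 : (1 < size q)%N.
  by rewrite -size_qk; apply: leq_trans gcd_gt1 (leq_gcdpr _ qk0).
have := @resultant_in_ideal _ (poly_XaY q) (map_poly polyC p).
rewrite size_poly_XaY size_map_polyC => /(_ q_gt1 p_gt1)[[u v] /= _].
move/(congr1 (map_poly (horner_eval (k%:R : K)))).
have evalC (r : {poly K}) :
    map_poly (horner_eval (k%:R : K)) (map_poly polyC r) = r.
  rewrite -map_poly_comp map_poly_id // => c _ /=.
  by rewrite /horner_eval hornerC.
have evalq : map_poly (horner_eval (k%:R : K)) (poly_XaY q) = qk.
  rewrite /poly_XaY map_comp_poly evalC rmorphD /= map_polyX map_polyC /=.
  by rewrite /horner_eval hornerX.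
rewrite -/(sub_annihilant q p) rmorphD !rmorphM /= map_polyC /= evalC evalq.
rewrite /horner_eval => Dr.
have dvd_r : gcdp p qk %| (sub_annihilant q p).[k%:R]%:P.
  by rewrite Dr dvdp_addr dvdp_mull ?dvdp_gcdl ?dvdp_gcdr.
apply/rootP/eqP; apply: contraTT gcd_gt1 => r0; rewrite -leqNgt.
by rewrite (leq_trans (dvdp_leq _ dvd_r)) ?polyC_eq0 // size_polyC leq_b1.
Qed.

Lemma has_common_shift_bounded (K : fieldType) (p q : {poly K}) :
  [pchar K] =i pred0 -> p != 0 -> q != 0 ->
  exists N : nat, forall k : nat, has_common_shift p q k -> (k <= N)%N.
Proof.
move=> charK0 p0 q0; pose r := sub_annihilant q p.
have r0 : r != 0 by apply: sub_annihilant_neq0.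
have natr_inj : injective (fun k : nat => k%:R : K).
  have lt_neq (i j : nat) : (i < j)%N -> i%:R != j%:R :> K.
    move=> lt_ij; rewrite eq_sym -subr_eq0 -natrB ?(ltnW lt_ij) //.
    by rewrite (pcharf0P K).1 // -lt0n subn_gt0.
  by move=> i j /eqP; case: (ltngtP i j) => // /lt_neq; rewrite 1?eq_sym => /negPf->.
apply: contrapT => unbounded.
have {}unbounded N : exists2 k, has_common_shift p q k & (N < k)%N.
  apply: contrapT => noN; apply: unbounded; exists N => k hk.
  by rewrite leqNgt; apply/negP => ltNk; apply: noN; exists k.
have [s [us ss sP]] : exists s : seq nat,
    [/\ uniq s, size s = size r & all (has_common_shift p q) s].
  elim: (size r) => [|m [s [us ss sP]]]; first by exists [::].
  have [k hk ltk] := unbounded (\max_(i <- s) i)%N.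
  exists (k :: s); split; rewrite /= ?ss ?hk // us andbT.
  apply: contraL ltk => ks; rewrite -leqNgt.
  by rewrite (big_rem k ks) /= leq_maxl.
have rs_roots : all (root r) [seq i%:R : K | i <- s].
  by rewrite all_map; apply: sub_all sP => i; apply: has_common_shift_root.
have := max_poly_roots r0 rs_roots.
by rewrite map_inj_uniq // size_map ss ltnn => /(_ us).
Qed.

Lemma disP (K : fieldType) (p q : {poly K}) :
    [pchar K] =i pred0 -> p != 0 -> q != 0 ->
  is_max_common_shift p q (dis p q) \/
  dis p q = -1 /\ forall k : nat, ~~ has_common_shift p q k.
Proof.
move=> charK0 p0 q0; rewrite /dis.
have [N leN] := has_common_shift_bounded charK0 p0 q0.
case: xgetP => [d _ dP|nodis]; [by left | right; split=> // k].
apply/negP => hk; have exk : exists k, has_common_shift p q k by exists k.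
case: (ex_maxnP exk leN) => m hm lem.
by apply: (nodis m%:Z); exists m.
Qed.

(* Main.v *)
(** Shifting [n] shows that [b(n+i)] and [a(n-j)] have a nontrivial common
    divisor iff [a(n-1)] and [b(n+i+j-1)] do, so they are coprime as soon as
    [i + j - 1 > k0].  Hence for [k > k0] the factors [b(n+i)] with [i > k0] and
    [a(n-j)] with [j > k0 + 1] contribute nothing to the gcd [G_k]. *)
Require Import Defs.
From mathcomp Require Import all_boot all_order all_algebra.
Import GRing.Theory.
Local Open Scope ring_scope.

Lemma shift_poly_comp (K : fieldType) (p : {poly K}) (x y : int) :
  shift_poly (shift_poly p x) y = shift_poly p (x + y).
Proof.
rewrite /shift_poly -comp_polyA comp_polyD comp_polyX comp_polyC.
by rewrite intrD polyCD -addrA [(y%:~R)%:P + _]addrC.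
Qed.

Lemma shift_poly_eq0 (K : fieldType) (p : {poly K}) (x : int) :
  (shift_poly p x == 0) = (p == 0).
Proof. by rewrite -!size_poly_eq0 size_comp_poly2 // size_XaddC. Qed.

Lemma coprimep_shift {K : fieldType} {p q : {poly K}} (x : int) :
  coprimep p q -> coprimep (shift_poly p x) (shift_poly q x).
Proof. exact: coprimep_comp_poly. Qed.

Lemma eqp_monic_gcd (K : fieldType) (p q p' q' : {poly K}) :
  gcdp p q %= gcdp p' q' -> monic_gcd p q = monic_gcd p' q'.
Proof.
rewrite /monic_gcd; set g := gcdp p q; set h := gcdp p' q' => gh.
have [g0|g0] := eqVneq g 0.
  by move: gh; rewrite g0 eqp_sym eqp0 => /eqP->.
have h0 : h != 0 by apply: contra_neq g0 => h0; apply/eqP; rewrite -eqp0 -h0.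
(* Multiplying by both leading coefficients clears the inverses and leaves the cross-multiplied
   identity [eqp_eq]. *)
apply: (scalerI (a := lead_coef g * lead_coef h)).
  by rewrite mulf_neq0 ?lead_coef_eq0.
rewrite !scalerA mulfK ?lead_coef_eq0 // mulrAC divff ?lead_coef_eq0 // mul1r.
exact: eqp_eq.
Qed.

Lemma has_common_shiftPn {K : fieldType} {p q : {poly K}} {k : nat} :
  p != 0 -> ~~ has_common_shift p q k -> coprimep p (shift_poly q k%:Z).
Proof.
move=> p0; rewrite /has_common_shift (eqp_size (monic_gcd_eqp _ _)) -leqNgt.
(* Since [p] is nonzero, so is the gcd; its size, at most 1, is thus exactly 1. *)
by rewrite /coprimep eqn_leq => ->; rewrite size_poly_gt0 gcdp_eq0 negb_and p0.
Qed.

(** As [dis p q] is at least -1, [absz] loses nothing and the bound means [dis p q < k]; at the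
    value -1 it admits every [k]. *)
Lemma dis_ltPn {K : fieldType} {p q : {poly K}} {k : nat} :
  [pchar K] =i pred0 -> p != 0 -> q != 0 ->
  (absz (dis p q + 1)%R <= k)%N -> ~~ has_common_shift p q k.
Proof.
move=> charK0 p0 q0; have [[d [-> _ maxd]]|[_ noshift] _] := disP charK0 p0 q0.
  by rewrite -PoszD addn1 ltnNge; apply: contra; apply: maxd.
exact: noshift.
Qed.

Lemma coprimep_shift_factors (K : fieldType) (a b : {poly K}) (i j : nat) :
    [pchar K] =i pred0 -> a != 0 -> b != 0 -> (0 < j)%N ->
    (absz (dis (shift_poly a (-1)) b + 1)%R < i + j)%N ->
  coprimep (shift_poly b i%:Z) (shift_poly a (- j%:Z)).
Proof.
(* From here [j] is one less than in the statement: a(n-1) and b(n+i+j) are coprime, and shifting by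
   -j gives a(n-j-1) and b(n+i). *)
case: j => // j charK0 a0 b0 _; rewrite addnS ltnS => le_ij.
have a1_neq0 : shift_poly a (-1) != 0 by rewrite shift_poly_eq0.
have := has_common_shiftPn a1_neq0 (dis_ltPn charK0 a1_neq0 b0 le_ij).
move=> /(coprimep_shift (- j%:Z)); rewrite !shift_poly_comp coprimep_sym.
by rewrite PoszD addrK -opprD -PoszD add1n.
Qed.

Lemma coprimep_prodr (K : fieldType) (I : eqType) (r : seq I) (F : I -> {poly K})
    (p : {poly K}) :
  {in r, forall i, coprimep p (F i)} -> coprimep p (\prod_(i <- r) F i).
Proof.
move=> cop; rewrite big_seq; elim/big_ind: _ => //; first exact: coprimep1.
by move=> q s cq cs; rewrite coprimepMr cq cs.
Qed.

Lemma coprimep_prod (K : fieldType) (I J : eqType) (r : seq I) (s : seq J)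
    (F : I -> {poly K}) (H : J -> {poly K}) :
  {in r & s, forall i j, coprimep (F i) (H j)} ->
  coprimep (\prod_(i <- r) F i) (\prod_(j <- s) H j).
Proof.
move=> cop; apply: coprimep_prodr => j js; rewrite coprimep_sym.
by apply: coprimep_prodr => i ir; rewrite coprimep_sym cop.
Qed.

(** Cancelling [p'] first means that [q'] need only be coprime to [p] afterwards. *)
Lemma gcdp_mul_coprime (K : fieldType) (p p' q q' : {poly K}) :
  coprimep p' (q * q') -> coprimep p q' -> gcdp (p * p') (q * q') %= gcdp p q.
Proof.
move=> cop' cop; apply: (@eqp_trans _ (gcdp p (q * q'))).
  apply: (eqp_trans (gcdpC _ _)); apply: eqp_trans (gcdpC _ _).
  by apply: Gauss_gcdpl; rewrite coprimep_sym.
exact: Gauss_gcdpl.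
Qed.

Theorem theorem2p1 (K : fieldType) (charK0 : [pchar K] =i pred0)
    (a b : {poly K}) (ha : a != 0) (hb : b != 0) :
  let k0 : int := dis (shift_poly a (-1)) b in
  poly_seq_converges (G_ a b) (G_ a b (absz (k0 + 1))).
Proof.
move=> k0; set m := absz _; exists m => k le_mk; apply: eqp_monic_gcd.
have cop i j : (0 < j)%N -> (m < i + j)%N ->
    coprimep (shift_poly b i%:Z) (shift_poly a (- j%:Z)).
  exact: coprimep_shift_factors.
(* The cuts differ by one because the second product starts at index 1; the two heads are those of
   [G_ a b m]. *)
rewrite (big_cat_nat (n := m)) //= [X in gcdp _ X](big_cat_nat (n := m.+1)) //=.
(* The second product is glued back for the tail of the first, where [m <= i] and [1 <= j]; against
   its own tail, [m < j] suffices. *)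
apply: gcdp_mul_coprime; rewrite -?big_cat_nat //; apply: coprimep_prod => i j;
  rewrite !mem_index_iota => /andP[le_i _] /andP[le_j _]; apply: cop => //.
- by rewrite -addn1 leq_add.
- by apply: leq_trans le_j.
- by apply: leq_trans le_j (leq_addl _ _).
Qed.
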